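(* Let $\alpha=\omega\nu$ with $\nu\ge1$ an ordinal. Then $R_\alpha|_{[0,1]}$ with the order topology is a compact Hausdorff space.
   Context: For an ordinal $\alpha=\omega\nu$, $\nu\ge1$ (a nonzero limit ordinal), let $A_\alpha$ be the set of all transfinite sequences $X_{(0,\alpha)}=(X_{\alpha'})_{0\le\alpha'<\alpha}$ with $X_{\alpha'}\in\{0,1\}$, ordered lexicographically: $X_{(0,\alpha)}<Y_{(0,\alpha)}$ iff there is $\alpha'<\alpha$ with $X_{\alpha'}=0$, $Y_{\alpha'}=1$ and $X_\beta=Y_\beta$ for all $\beta<\alpha'$. Such a pair is called a pair of twins if in addition $X_\beta=1$ and $Y_\beta=0$ for all $\beta$ with $\alpha'<\beta<\alpha$. $R_\alpha|_{[0,1]}$ is the quotient set $A_\alpha/{\sim}$, where $\sim$ identifies the two members of each pair of twins, with the induced linear order. *)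

(* Defs.v *)
(* MathComp-Analysis *)
From HB Require Import structures.
From mathcomp Require Import all_boot all_order.
From mathcomp Require Import generic_quotient.
From mathcomp Require Import all_classical.
From mathcomp Require Import wochoice topology.

Set Implicit Arguments.
Unset Strict Implicit.
Unset Printing Implicit Defensive.

Import Order.TTheory.
Local Open Scope order_scope.
Local Open Scope quotient_scope.

(* An ordinal is represented by a well-ordered type of that order type; its
   elements play the role of the smaller ordinals.  Equality of ordinals is
   order isomorphism [ord_iso]. *)
HB.mixin Record Total_isWellOrder d T & Order.Total d T := {
  le_well_order : well_order (<=%O : rel T)
}.

#[short(type="wellOrdType")]
HB.structure Definition WellOrd d :=
  { T of Order.Total d T & Total_isWellOrder d T }.

(* The empty order qualifies: the ordinal 0 counts as a limit here. *)
HB.mixin Record WellOrd_isLimit d T & WellOrd d T := {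
  limit_no_max : forall x : T, exists y : T, x < y
}.

#[short(type="limitOrdType")]
HB.structure Definition LimitOrd d :=
  { T of WellOrd d T & WellOrd_isLimit d T }.

Definition ord_iso d1 d2 (A : porderType d1) (B : porderType d2) : Prop :=
  exists f : A -> B, bijective f /\ {mono f : x y / x <= y}.

(* The ordinal product omega.nu consists of nu successive copies of omega,
   hence the nu-component is the most significant one. *)
Definition omega_mul d (nu : porderType d) : Type := (nu *l nat)%type.

Section WellOrdTheory.
Context d (T : wellOrdType d).

Lemma wo_min (P : T -> Prop) : (exists x, P x) ->
  exists x, P x /\ forall y, P y -> x <= y.
Proof.
move=> [x Px].
have /le_well_order : nonempty ([pred y | `[< P y >]] : {pred T}).
  by exists x; rewrite inE.
move=> [m [[]]]; rewrite inE => Pm mmin _; exists m; split=> // y Py.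
by apply: mmin; rewrite inE.
Qed.
End WellOrdTheory.

Section OmegaMul.
Context d (nu : wellOrdType d).
Local Notation T := (omega_mul nu).

HB.instance Definition _ := Order.Total.on T.

Lemma omega_mul_well_order : well_order (<=%O : rel T).
Proof.
apply: antisymmetric_well_order; first exact: le_anti.
move=> A [[a k] Aak].
have [|b [[l Abl] bmin]] := @wo_min _ nu (fun b => exists l : nat, (b, l) \in A).
  by exists a, k.
have exl : exists l : nat, ((b, l) : T) \in A by exists l.
case: (ex_minnP exl) => m Am mmin.
exists (b, m); split=> // -[c n] Acn.
rewrite Order.ProdLexiOrder.leEprodlexi /=; apply/andP; split.
  by apply: bmin; exists n.
apply/implyP => cb; apply: mmin.
have -> // : b = c.
by apply/le_anti; rewrite cb andbT; apply: bmin; exists n.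
Qed.
HB.instance Definition _ := Total_isWellOrder.Build _ T omega_mul_well_order.

Lemma omega_mul_no_max (x : T) : exists y : T, x < y.
Proof.
case: x => a n; exists (a, n.+1).
rewrite Order.ProdLexiOrder.ltEprodlexi /= lexx /=.
exact: ltnSn.
Qed.
HB.instance Definition _ := WellOrd_isLimit.Build _ T omega_mul_no_max.
End OmegaMul.

(* A_alpha; the entries 0 and 1 are [false] and [true]. *)
Definition binseq (T : Type) : Type := T -> bool.

Fact binseq_display : Order.disp_t. Proof. exact: Order.Disp tt tt. Qed.

Section BinSeq.
Context d (alpha : wellOrdType d).
Local Notation A := (binseq alpha).
Implicit Types X Y Z : A.

HB.instance Definition _ := Choice.copy A (forall _ : alpha, bool).

Definition jumps_at (a : alpha) X Y : Prop :=
  [/\ X a = false, Y a = true & forall b, b < a -> X b = Y b].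

Definition lex_lt X Y : bool := `[< exists a, jumps_at a X Y >].

Definition twins X Y : Prop := exists a, jumps_at a X Y /\
  forall b, a < b -> X b = true /\ Y b = false.

Definition twin_rel X Y : bool := `[< [\/ X = Y, twins X Y | twins Y X] >].

Fact lex_lt_irr : irreflexive lex_lt.
Proof. by move=> X; apply/asboolP => -[a [-> ]]. Qed.

Fact lex_lt_trans : transitive lex_lt.
Proof.
move=> Y X Z /asboolP[a [Xa Ya XY]] /asboolP[b [Yb Zb YZ]]; apply/asboolP.
have [ab|ba|e] := ltgtP a b.
- exists a; split=> //; first by rewrite -YZ.
  by move=> c ca; rewrite XY// YZ// (lt_trans ca).
- exists b; split=> //; first by rewrite XY.
  by move=> c cb; rewrite XY ?YZ// (lt_trans cb).
- by move: Yb; rewrite -e Ya.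
Qed.

HB.instance Definition _ :=
  Order.Lt_isPOrder.Build binseq_display A lex_lt_irr lex_lt_trans.

Lemma ltEbinseq X Y : (X < Y) = lex_lt X Y. Proof. by []. Qed.

Fact lex_total : total (<=%O : rel A).
Proof.
move=> X Y; have [->|XY] := eqVneq X Y; first by rewrite lexx.
have [|a [Xa amin]] := @wo_min _ alpha (fun a => X a <> Y a).
  by apply/existsNP => XY'; move/eqP: XY; apply; apply/funext.
have agree b : b < a -> X b = Y b.
  by move=> ba; apply: contrapT => /amin; rewrite leNgt ba.
rewrite !le_eqVlt !ltEbinseq /lex_lt.
have [[Xa0 Ya1]|[Xa1 Ya0]] : (X a = false /\ Y a = true) \/
    (X a = true /\ Y a = false).
- by case: (X a) (Y a) Xa => -[]//; [right|left].
- by apply/orP; left; apply/orP; right; apply/asboolP; exists a.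
- apply/orP; right; apply/orP; right; apply/asboolP; exists a; split=> // b ba.
  by rewrite agree.
Qed.
HB.instance Definition _ := Order.POrder_isTotal.Build _ A lex_total.

Lemma twins_lt X Y : twins X Y -> X < Y.
Proof. by move=> [a [h _]]; rewrite ltEbinseq; apply/asboolP; exists a. Qed.

Lemma twins_adjacent X Y Z : twins X Y -> X < Z -> Z < Y -> False.
Proof.
move=> [a [[Xa Ya XY] tl]]; rewrite !ltEbinseq.
move=> /asboolP[b [Xb Zb XZ]] /asboolP[c [Zc Yc ZY]].
have [ab|ba|e] := ltgtP a b.
- by move: Xb; rewrite (tl _ ab).1.
- have [bc|cb|e] := ltgtP b c.
  + by move: Zb; rewrite ZY// -XY// Xb.
  + by move: Zc; rewrite -XZ// XY ?Yc// (lt_trans cb).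
  + by move: Zb; rewrite e Zc.
- move: e Xb Zb XZ => <- _ Za XZ.
  have [ac|ca|e] := ltgtP a c.
  + by move: Yc; rewrite (tl _ ac).2.
  + by move: Zc; rewrite -XZ// XY// Yc.
  + by move: Zc; rewrite -e Za.
Qed.

Lemma twins_uniq_r X Y Z : twins X Y -> twins X Z -> Y = Z.
Proof.
move=> XY XZ; have [h|h|//] := ltgtP Y Z; exfalso.
- exact: (twins_adjacent XZ (twins_lt XY) h).
- exact: (twins_adjacent XY (twins_lt XZ) h).
Qed.

Lemma twins_uniq_l X Y Z : twins X Z -> twins Y Z -> X = Y.
Proof.
move=> XZ YZ; have [h|h|//] := ltgtP X Y; exfalso.
- exact: (twins_adjacent XZ h (twins_lt YZ)).
- exact: (twins_adjacent YZ h (twins_lt XZ)).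
Qed.
End BinSeq.

Section Quotient.
Context d (alpha : limitOrdType d).
Local Notation A := (binseq alpha).
Implicit Types X Y Z : A.

Lemma twins_no_chain X Y Z : twins X Y -> twins Y Z -> False.
Proof.
move=> [a [_ ta]] [b [_ tb]].
have [c] := limit_no_max (Order.max a b); rewrite gt_max => /andP[ac bc].
by move: (ta c ac).2; rewrite (tb c bc).1.
Qed.

Fact twin_refl : reflexive (@twin_rel d alpha).
Proof. by move=> X; apply/asboolP; constructor 1. Qed.

Fact twin_sym : symmetric (@twin_rel d alpha).
Proof.
by move=> X Y; apply/asboolP/asboolP => -[->|?|?];
  [constructor 1|constructor 3|constructor 2|
   constructor 1|constructor 3|constructor 2].
Qed.

Fact twin_trans : transitive (@twin_rel d alpha).
Proof.
move=> Y X Z /asboolP[->//|XY|YX] /asboolP[<-|YZ|ZY].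
- by apply/asboolP; constructor 2.
- by case: (twins_no_chain XY YZ).
- by rewrite (twins_uniq_l XY ZY); exact: twin_refl.
- by apply/asboolP; constructor 3.
- by rewrite (twins_uniq_r YX YZ); exact: twin_refl.
- by case: (twins_no_chain ZY YX).
Qed.

Canonical twin_equiv :=
  EquivRel (@twin_rel d alpha) twin_refl twin_sym twin_trans.

(* R_alpha|_[0,1] *)
Definition Runit : Type := {eq_quot twin_equiv}.
HB.instance Definition _ := EqQuotient.on Runit.
HB.instance Definition _ := Choice.on Runit.

Implicit Types p q r : Runit.

Definition Runit_le p q : bool :=
  `[< exists X Y : A, [/\ \pi_Runit X = p, \pi_Runit Y = q & X <= Y] >].

Lemma pi_twinP X Y :
  \pi_Runit X = \pi_Runit Y <-> [\/ X = Y, twins X Y | twins Y X].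
Proof.
split=> [/eqquotP/asboolP//|h]; apply/eqquotP; exact/asboolP.
Qed.

Lemma le_twin_r X Y Y' : X <= Y -> \pi_Runit Y = \pi_Runit Y' ->
  X <= Y' \/ \pi_Runit X = \pi_Runit Y'.
Proof.
move=> XY /pi_twinP[<-|/twins_lt/ltW h|h]; first by left.
  by left; exact: le_trans h.
have [|Y'X] := leP X Y'; first by left.
right; move: XY; rewrite le_eqVlt => /predU1P[->|XY].
  by apply/pi_twinP; constructor 3.
by case: (twins_adjacent h Y'X XY).
Qed.

Fact Runit_le_refl : reflexive Runit_le.
Proof. by move=> p; apply/asboolP; exists (repr p), (repr p); rewrite !reprK. Qed.

Fact Runit_le_trans : transitive Runit_le.
Proof.
move=> q p r /asboolP[X [Y [<- <- XY]]] /asboolP[Y' [Z [Yq <- YZ]]].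
have [XY'|->] := le_twin_r XY (esym Yq); apply/asboolP.
  by exists X, Z; split=> //; exact: le_trans YZ.
by exists Y', Z.
Qed.

Fact Runit_le_anti : antisymmetric Runit_le.
Proof.
move=> p q /andP[/asboolP[X [Y [<- <- XY]]] /asboolP[Y' [X' [Yq Xp YX]]]].
have [XY'|->//] := le_twin_r XY (esym Yq).
have [YX'|] := le_twin_r YX Xp; last by rewrite Yq => ->.
by rewrite -Yq; congr (\pi _); apply/le_anti; rewrite XY'.
Qed.

Fact Runit_display : Order.disp_t. Proof. exact: Order.Disp tt tt. Qed.

HB.instance Definition _ := Order.Le_isPOrder.Build Runit_display Runit
  Runit_le_refl Runit_le_anti Runit_le_trans.

Lemma leERunit p q : (p <= q) = Runit_le p q. Proof. by []. Qed.

Fact Runit_le_total : total (<=%O : rel Runit).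
Proof.
move=> p q; have /orP[h|h] := le_total (repr p) (repr q); apply/orP.
  by left; apply/asboolP; exists (repr p), (repr q); rewrite !reprK.
by right; apply/asboolP; exists (repr q), (repr p); rewrite !reprK.
Qed.
HB.instance Definition _ := Order.POrder_isTotal.Build _ Runit Runit_le_total.
End Quotient.

Arguments Runit {d} alpha.

(* Main.v *)
(* The lexicographic order on binary sequences is complete: the supremum of [S]
   takes the value 1 at [a] exactly when some member of [S] has a 1 at [a] and
   agrees below [a] with the supremum.  Completeness passes to the quotient by
   the twin relation, because the chosen representatives are ordered as their
   classes.  A complete linear order is compact: an ultrafilter [F] converges to
   the supremum of the points [x] such that [[x, +oo[] belongs to [F]. *)
Require Import Defs.
From mathcomp Require Import all_boot all_order all_classical topology.
From mathcomp Require Import generic_quotient interval.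

Set Implicit Arguments.
Unset Strict Implicit.
Unset Printing Implicit Defensive.

Import Order.TTheory.
Local Open Scope order_scope.
Local Open Scope classical_set_scope.

Lemma compact_complete_order d (T : orderTopologicalType d) :
  (forall S : set T, supremums S !=set0) -> compact [set: T].
Proof.
move=> supT; rewrite compact_ultra => F FU _.
have [s [ubs lubs]] := supT [set x : T | F `[x, +oo[%classic].
exists s; split=> // U; rewrite itv_nbhsE => -[i [oi si] iU].
apply: (filterS iU).
have above a : a < s -> F `]a, +oo[%classic.
  move=> a_s; have [x [Fx ax]] : exists x : T, F `[x, +oo[%classic /\ a < x.
    apply: contrapT => noX; move: a_s; rewrite ltNge => /negP; apply.
    apply: lubs => x Fx; rewrite leNgt; apply/negP => ax.
    by apply: noX; exists x.
  apply: filterS Fx => y /=; rewrite !in_itv/= !andbT; exact: lt_le_trans.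
have below b : s < b -> F `]-oo, b[%classic.
  (* If [[b, +oo[] is in [F], then [b <= s]; otherwise the ultrafilter contains its complement. *)
  move=> sb; have [Fb|] := in_ultra_setVsetC `[b, +oo[%classic FU.
    by move: sb; rewrite ltNge => /negP[]; exact: ubs.
  by rewrite setCitvr.
case: i oi si {iU} => l r oi /andP[sl sr].
rewrite set_itv_splitI; apply: filterI.
- case: l oi sl {sr} => [c a|c] oi.
    rewrite (itv_open_ends_lside oi) => al; exact: above.
  by rewrite (itv_open_ends_linfty oi) set_itvE => _; exact: filterT.
- case: r oi sr {sl} => [c b|c] oi.
    rewrite (itv_open_ends_rside oi) => sb; exact: below.
  by rewrite (itv_open_ends_rinfty oi) set_itvE => _; exact: filterT.
Qed.

Section LexSup.
Context d (alpha : wellOrdType d).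
Implicit Types (X Y Z : binseq alpha) (S : set (binseq alpha)).

(** No member of [S] has a lexicographically greater prefix below [a] than [X]. *)
Definition first_below S (a : alpha) X : Prop :=
  forall Y b, S Y -> b < a -> ~ jumps_at b X Y.

(* Stating maximality of the prefix of [X] within [S], instead of agreement with
   the supremum, avoids a transfinite recursion. *)
Definition lex_sup S : binseq alpha :=
  fun a => `[< exists X, [/\ S X, X a = true & first_below S a X] >].

Lemma lex_ltP X Y : reflect (exists a, jumps_at a X Y) (X < Y).
Proof. by rewrite ltEbinseq; exact: asboolP. Qed.

Lemma lex_sup_ubound S : ubound S (lex_sup S).
Proof.
move=> Y SY; rewrite leNgt; apply/negP => /lex_ltP[a [La Ya LY]].
have [[Z [b [SZ ba jb]]]|none] :=
    pselect (exists Z b, [/\ S Z, b < a & jumps_at b Y Z]); last first.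
  move/asboolP: La; apply; exists Y; split=> // Z b SZ ba jb.
  by apply: none; exists Z, b.
(* At the least index [c] where some [W] in [S] overtakes [Y], the prefix of [W] is maximal. This
   forces the value 1 at [c], where [Y] and the supremum are 0. *)
have [|c [[W [SW ca [Yc Wc YW]]] cmin]] := @wo_min _ alpha
  (fun b => exists Z, [/\ S Z, b < a & jumps_at b Y Z]).
  by exists b, Z.
have : lex_sup S c = false by rewrite LY.
move/asboolP; apply; exists W; split=> // V e SV ec [We Ve WV].
suff /cmin : exists V, [/\ S V, e < a & jumps_at e Y V] by rewrite leNgt ec.
exists V; split=> //; first exact: lt_trans ca.
by split=> [||f fe] //; [rewrite YW|rewrite YW ?WV// (lt_trans fe)].
Qed.

(** At a first difference below [a], one of the two would overtake the other. *)
Lemma first_below_agree S a X Y : S X -> S Y ->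
  first_below S a X -> first_below S a Y -> forall b, b < a -> X b = Y b.
Proof.
move=> SX SY fX fY b ba.
have [/lex_ltP[c j]|/lex_ltP[c j]|->//] := ltgtP X Y.
- have [ca|ac] := ltP c a; first by case: (fX _ _ SY ca j).
  by case: j => _ _ ->//; exact: lt_le_trans ac.
- have [ca|ac] := ltP c a; first by case: (fY _ _ SX ca j).
  by case: j => _ _ ->//; exact: lt_le_trans ac.
Qed.

Lemma lex_sup_least S : lbound (ubound S) (lex_sup S).
Proof.
move=> U ubU; rewrite leNgt; apply/negP => /lex_ltP[a [Ua /asboolP La UL]].
have [X [SX Xa fX]] := La.
have := ubU _ SX; rewrite le_eqVlt => /predU1P[XU|/lex_ltP[c [Xc Uc XU]]].
  by move: Ua; rewrite -XU Xa.
have [ca|ac|e] := ltgtP c a.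
(* The witness [W] for the value 1 at [c] overtakes [X] there, against the maximality of the prefix
   of [X] below [a]. *)
- have /asboolP[W [SW Wc fW]] : lex_sup S c = true by rewrite -UL.
  apply: (fX W c SW ca); split=> //.
  apply: (first_below_agree SX SW) fW => Y b SY bc.
  by apply: fX => //; exact: lt_trans ca.
- by move: Xa; rewrite XU// Ua.
- by move: Xa; rewrite -e Xc.
Qed.
End LexSup.

Section QuotientSup.
Context d (alpha : limitOrdType d).
Implicit Types (p q : Runit alpha) (X Y : binseq alpha).
Local Notation pi := (\pi_(Runit alpha)%qT).

Lemma pi_le X Y : X <= Y -> pi X <= pi Y.
Proof. by move=> XY; apply/asboolP; exists X, Y. Qed.

(** A strict reversal of the representatives would, by antisymmetry in the quotient, make the
    classes equal. *)
Lemma repr_le p q : p <= q -> repr p <= repr q.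
Proof.
move=> pq; rewrite leNgt; apply/negP => qp.
have := pi_le (ltW qp); rewrite !reprK => qp'.
have e : p = q by apply/le_anti; rewrite pq.
by move: qp; rewrite e ltxx.
Qed.

Lemma Runit_supremums (S : set (Runit alpha)) : supremums S !=set0.
Proof.
exists (pi (lex_sup (repr @` S))); split=> [p Sp|q ubq].
  by rewrite -[p]reprK; apply/pi_le/lex_sup_ubound; exists p.
rewrite -[q]reprK; apply/pi_le/lex_sup_least => _ [p Sp <-].
exact/repr_le/ubq.
Qed.
End QuotientSup.

Theorem theorem8 (d d' : Order.disp_t) (alpha : limitOrdType d)
    (nu : wellOrdType d') (nu_ge1 : inhabited nu)
    (alphaE : ord_iso alpha (omega_mul nu)) :
  hausdorff_space (order_topology (Runit alpha)) /\
  compact [set: order_topology (Runit alpha)]%classic.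
Proof.
split; first exact: order_hausdorff.
by apply: compact_complete_order => S; exact: Runit_supremums.
Qed.
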